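(* Let $K\ge 2$ and $1\le M\le K-1$ be integers, let $c>0$, $\Delta f>0$, $\sigma_w^2>0$, let $\beta_{n1}\in\mathbb{C}\setminus\{0\}$ and $z_{n1}=e^{-j2\pi\Delta f\tau_{n1}}$ with $\tau_{n1}\in\mathbb{R}$. Let the observations be $\bar h_{nk}=\beta_{n1}z_{n1}^k+w_{nk}$, $k=0,\dots,K-1$, where the $w_{nk}$ are i.i.d. zero-mean circularly symmetric complex Gaussian random variables with $\mathbb{E}|w_{nk}|^2=\sigma_w^2$. Then the high-SNR (first-order) variance of the LoS distance estimate $\hat d_{n1}$ produced by the matrix-pencil (MP) ranging algorithm from these observations is $$V_{\mathrm{MP},n}=\left(\frac{c}{2\pi\Delta f}\right)^2\frac{\sigma_w^2}{|\beta_{n1}|^2}\,\mathcal{F}_{\mathrm{MP}}(M,K),\qquad \mathcal{F}_{\mathrm{MP}}(M,K)=\begin{cases}\dfrac{1}{(K-M)^2M}, & M\le \dfrac K2,\\[2ex] \dfrac{1}{(K-M)M^2}, & M\ge \dfrac K2.\end{cases}$$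
   Context: MP ranging algorithm (single LoS path). Put $G=K-M$. Given $h=(h_0,\dots,h_{K-1})\in\mathbb{C}^K$, form the $M\times G$ Hankel matrices $\bar{\mathbf H}_0(h)$ and $\bar{\mathbf H}_1(h)$ with entries $[\bar{\mathbf H}_0]_{p,q}=h_{p+q}$ and $[\bar{\mathbf H}_1]_{p,q}=h_{p+q+1}$ for $0\le p\le M-1$, $0\le q\le G-1$. Let $\mathbf u$ be a unit left singular vector of $\bar{\mathbf H}_0$ associated with its largest singular value (one path is retained, i.e. the estimated number of paths is $\hat L=1$). Set $\mathbf H_{0s}=\mathbf u^H\bar{\mathbf H}_0$ and $\mathbf H_{1s}=\mathbf u^H\bar{\mathbf H}_1$. The pole estimate is the single eigenvalue of the $1\times1$ matrix $\mathbf H_{1s}\mathbf H_{0s}^\dagger$, where $\dagger$ is the Moore–Penrose pseudo-inverse: $$\hat z_{n1}(h)=\mathbf H_{1s}\mathbf H_{0s}^\dagger .$$ This does not depend on the phase of $\mathbf u$. It is well defined for $h$ near $h^{o}$, where $h^o_k=\beta_{n1}z_{n1}^k$; there the largest singular value is simple and $\hat z_{n1}(h^o)=z_{n1}$. The delay and distance estimates are $$\hat\tau_{n1}=-\frac{\arg \hat z_{n1}}{2\pi\Delta f},\qquad \hat d_{n1}=c\,\hat\tau_{n1}=-\frac{c}{2\pi\Delta f}\arg\hat z_{n1},$$ with $\arg$ a branch continuous near $z_{n1}$. High-SNR (first-order) variance. With $w=(w_{n0},\dots,w_{n(K-1)})$, the first-order distance error is the random variable $$\frac{d}{dt}\Big|_{t=0}\hat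 d_{n1}(h^{o}+t\,w),$$ where the derivative is in real $t$. The high-SNR (first-order) variance of $\hat d_{n1}$ is the variance of this random variable. *)

(* Defs.v *)
From HB Require Import structures.
From mathcomp Require Import all_boot all_order all_algebra.
From mathcomp Require Import all_classical all_reals all_analysis.
From mathcomp Require Import sesquilinear spectral complex zify.

Set Implicit Arguments.
Unset Strict Implicit.
Unset Printing Implicit Defensive.

Import Order.TTheory GRing.Theory Num.Theory.
Import numFieldNormedType.Exports.

Local Open Scope classical_set_scope.
Local Open Scope ring_scope.
Local Open Scope complex_scope.
Local Open Scope sesquilinear_scope.

Section complex_numbers.
Context {R : realType}.

(* e^{j theta} *)
Definition expi (theta : R) : R[i] := cos theta +i* sin theta.

Definition modulus (z : R[i]) : R :=
  Num.sqrt (complex.Re z ^+ 2 + complex.Im z ^+ 2).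

(* [arg] is only constrained near z0: there it is a continuous choice of the
   argument. The alias ^o gives R[i] its usual (norm) topology. *)
Definition arg_branch_near (arg : R[i] -> R) (z0 : R[i]) : Prop :=
  \forall z \near (z0 : R[i]^o),
    z = (modulus z)%:C * expi (arg z) /\
    {for z, continuous (arg : R[i]^o -> R^o)}.

End complex_numbers.

Section singular_vectors.
Context {R : realType}.

Definition unit_vector n (u : 'cV[R[i]]_n) : Prop := u^t* *m u = 1%:M.

Definition singular_triple m n (A : 'M[R[i]]_(m, n)) (s : R)
    (u : 'cV[R[i]]_m) (v : 'cV[R[i]]_n) : Prop :=
  [/\ 0 <= s, unit_vector u, unit_vector v,
      A *m v = s%:C *: u & A^t* *m u = s%:C *: v].

Definition singular_value m n (A : 'M[R[i]]_(m, n)) (s : R) : Prop :=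
  exists u v, singular_triple A s u v.

Definition largest_singular_value m n (A : 'M[R[i]]_(m, n)) (s : R) : Prop :=
  singular_value A s /\ forall s', singular_value A s' -> s' <= s.

(* u is a unit left singular vector of A for the largest singular value of A. *)
Definition top_left_singular_vector m n (A : 'M[R[i]]_(m, n))
    (u : 'cV[R[i]]_m) : Prop :=
  exists s, largest_singular_value A s /\ exists v, singular_triple A s u v.

(* The four Penrose equations. *)
Definition is_moore_penrose m n (A : 'M[R[i]]_(m, n))
    (X : 'M[R[i]]_(n, m)) : Prop :=
  [/\ A *m X *m A = A, X *m A *m X = X,
      (A *m X)^t* = A *m X & (X *m A)^t* = X *m A].

(* [pinvmx] is not used: it is a partial inverse without the two Hermitian
   conditions. The default value 0 is never taken, as a solution of the Penrose
   equations exists, and it is unique. *)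
Definition moore_penrose m n (A : 'M[R[i]]_(m, n)) : 'M[R[i]]_(n, m) :=
  xget 0 [set X | is_moore_penrose A X].

End singular_vectors.

Section matrix_pencil.
Context {R : realType}.

Lemma hankel0_subproof (K M : nat) (p : 'I_M) (q : 'I_(K - M)) :
  (p + q < K)%N.
Proof. by case: p q => p pM [q /= qG]; lia. Qed.

Lemma hankel1_subproof (K M : nat) (p : 'I_M) (q : 'I_(K - M)) :
  ((p + q).+1 < K)%N.
Proof. by case: p q => p pM [q /= qG]; lia. Qed.

Definition hankel0 (K M : nat) (h : 'rV[R[i]]_K) : 'M[R[i]]_(M, K - M) :=
  \matrix_(p < M, q < K - M) h 0 (Ordinal (hankel0_subproof p q)).

Definition hankel1 (K M : nat) (h : 'rV[R[i]]_K) : 'M[R[i]]_(M, K - M) :=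
  \matrix_(p < M, q < K - M) h 0 (Ordinal (hankel1_subproof p q)).

(* A singular vector is determined only up to a choice (of phase, at least), so
   the algorithm is parameterized by the vector u h that it extracts from the
   data h. *)
Definition svd_choice (K M : nat) (u : 'rV[R[i]]_K -> 'cV[R[i]]_M) : Prop :=
  forall h, top_left_singular_vector (hankel0 M h) (u h).

(* The eigenvalue of the 1 x 1 matrix H1s H0s^dagger is its only entry. *)
Definition mp_pole (K M : nat) (u : 'rV[R[i]]_K -> 'cV[R[i]]_M)
    (h : 'rV[R[i]]_K) : R[i] :=
  let H0s := (u h)^t* *m hankel0 M h in
  let H1s := (u h)^t* *m hankel1 M h in
  (H1s *m moore_penrose H0s) 0 0.

Definition mp_delay (K M : nat) (Df : R) (arg : R[i] -> R)
    (u : 'rV[R[i]]_K -> 'cV[R[i]]_M) (h : 'rV[R[i]]_K) : R :=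
  - (arg (mp_pole u h) / (2 * pi * Df)).

Definition mp_distance (K M : nat) (c Df : R) (arg : R[i] -> R)
    (u : 'rV[R[i]]_K -> 'cV[R[i]]_M) (h : 'rV[R[i]]_K) : R :=
  c * mp_delay Df arg u h.

Definition los_response (K : nat) (beta z : R[i]) : 'rV[R[i]]_K :=
  \row_(k < K) (beta * z ^+ k).

(* Observations with the noise w scaled by t; the actual observations are those
   for t = 1. *)
Definition observation (K : nat) (beta z : R[i]) (w : 'I_K -> R[i]) (t : R) :
    'rV[R[i]]_K :=
  los_response K beta z + t%:C *: \row_(k < K) w k.

(* The two cases M <= K/2 and M >= K/2 agree when 2 M = K. *)
Definition F_MP (M K : nat) : R :=
  if (M.*2 <= K)%N then ((K - M)%:R ^+ 2 * M%:R)^-1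
  else ((K - M)%:R * M%:R ^+ 2)^-1.

End matrix_pencil.

Section complex_random_variables.
Context d (T : measurableType d) (R : realType) (P : probability T R).
Implicit Types (X : T -> R) (Z : T -> R[i]).

(* R[i] carries no sigma-algebra in the library: events on complex random
   variables are expressed through C = R x R with the product sigma-algebra. *)
Definition real_pair (z : R[i]) : (R * R)%type := (complex.Re z, complex.Im z).

Definition complex_event Z (B : set (R * R)) : set T :=
  [set omega | B (real_pair (Z omega))].

Definition complex_measurable Z : Prop :=
  measurable_fun [set: T] (fun omega => real_pair (Z omega)).

(* A degenerate Gaussian is a Dirac mass; [normal_prob m 0] is not. *)
Definition gaussian X : Prop :=
  exists m s : R, forall B : set R, measurable B ->
    P (X @^-1` B) = if s == 0 then \d_m B else normal_prob m s B.

(* (Re Z, Im Z) is a Gaussian vector of R^2: all its linear images are Gaussian. *)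
Definition complex_gaussian Z : Prop :=
  forall a b : R,
    gaussian (fun omega => a * complex.Re (Z omega) + b * complex.Im (Z omega)).

Definition circularly_symmetric Z : Prop :=
  forall (theta : R) (B : set (R * R)), measurable B ->
    P (complex_event (fun omega => expi theta * Z omega) B) =
    P (complex_event Z B).

Definition zero_mean Z : Prop :=
  ('E_P[fun omega => complex.Re (Z omega)] = 0)%E /\
  ('E_P[fun omega => complex.Im (Z omega)] = 0)%E.

Definition mutually_independent (I : finType) (Z : I -> T -> R[i]) : Prop :=
  forall (J : {set I}) (B : I -> set (R * R)), (forall i, measurable (B i)) ->
    P (\bigcap_(i in [set` J]) complex_event (Z i) (B i)) =
    (\prod_(i in J) P (complex_event (Z i) (B i)))%E.

Definition identically_distributed (I : Type) (Z : I -> T -> R[i]) : Prop :=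
  forall (i j : I) (B : set (R * R)), measurable B ->
    P (complex_event (Z i) B) = P (complex_event (Z j) B).

Definition iid_cscg (sigma2 : R) (I : finType) (Z : I -> T -> R[i]) : Prop :=
  [/\ forall i, complex_measurable (Z i),
      mutually_independent Z,
      identically_distributed Z &
      forall i, [/\ complex_gaussian (Z i), circularly_symmetric (Z i),
        zero_mean (Z i) &
        ('E_P[fun omega => (modulus (Z i omega) ^+ 2)%R] = sigma2%:E)%E]].

End complex_random_variables.

Section first_order.
Context {R : realType}.

(* The map t |-> d(h_o + t w) whose derivative at 0 is the first-order error. *)
Definition distance_along_noise (K M : nat) (c Df : R) (arg : R[i] -> R)
    (u : 'rV[R[i]]_K -> 'cV[R[i]]_M) (beta z : R[i]) (w : 'I_K -> R[i])
    (t : R) : R :=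
  mp_distance c Df arg u (observation beta z w t).

Definition first_order_error (K M : nat) (c Df : R) (arg : R[i] -> R)
    (u : 'rV[R[i]]_K -> 'cV[R[i]]_M) (beta z : R[i]) (w : 'I_K -> R[i]) : R :=
  derive1 (distance_along_noise c Df arg u beta z w : R -> R^o) 0.

Definition high_snr_variance d (T : measurableType d) (P : probability T R)
    (K M : nat) (c Df : R) (arg : R[i] -> R)
    (u : 'rV[R[i]]_K -> 'cV[R[i]]_M) (beta z : R[i]) (w : 'I_K -> T -> R[i]) :
    \bar R :=
  ('V_P[fun omega => first_order_error c Df arg u beta z (w ^~ omega)])%E.

End first_order.

(* Main.v *)
(* Along h = h^o + t w the Hankel matrices satisfy H1 - z H0 = t D with
   D = N1 - z N0 built from the noise. With Q the orthogonal projector on the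
   retained left singular vector, the pole estimate is therefore
   z + t tr(D H0^* Q) / tr(H0 H0^* Q), so its derivative at t = 0 only needs Q
   to be continuous at 0: no derivative of the singular vector is taken.
   Continuity follows from the maximality of the Rayleigh quotient u^* H0 H0^* u
   and from the noiseless H0 H0^* being a multiple of a rank one projector.
   The derivative is a^* D conj(b) / (beta M G), with a and b the steering
   vectors of lengths M and G = K - M. After multiplication by conj(z) this
   double sum telescopes in its longer direction and leaves
   2 min(M, G) noise samples with weights of equal modulus, which are pairwise
   uncorrelated. *)

Require Import Defs.
From HB Require Import structures.
From mathcomp Require Import all_boot all_order all_algebra.
From mathcomp Require Import all_classical all_reals all_analysis.
From mathcomp Require Import sesquilinear spectral complex.
From mathcomp Require Import measurable_realfun ring lra zify.

Set Implicit Arguments.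
Unset Strict Implicit.
Unset Printing Implicit Defensive.

Import Order.TTheory GRing.Theory Num.Theory.
Import numFieldNormedType.Exports.

Local Open Scope classical_set_scope.
Local Open Scope ring_scope.
Local Open Scope complex_scope.

(** * Rayleigh quotients and singular values *)

Section singular_values.
Context {R : realType}.
Local Notation C := R[i].
Local Open Scope sesquilinear_scope.

Lemma adjmx_mul m n p (A : 'M[C]_(m, n)) (B : 'M[C]_(n, p)) :
  (A *m B)^t* = B^t* *m A^t*.
Proof. by rewrite trmx_mul map_mxM. Qed.

Lemma adjmxZ m n (a : C) (A : 'M[C]_(m, n)) : (a *: A)^t* = Num.conj a *: A^t*.
Proof. by rewrite linearZ /= map_mxZ. Qed.

Lemma conjC_realc (x : R) : Num.conj (x%:C : C) = x%:C.
Proof. by apply/conj_Creal/complex_realP; exists x. Qed.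

Lemma dot_selfE n (x : 'cV[C]_n) : (x^t* *m x) 0 0 = \sum_i `|x i 0| ^+ 2.
Proof.
by rewrite mxE; apply: eq_bigr => i _; rewrite !mxE normCK mulrC.
Qed.

Lemma gram_formE m n (H : 'M[C]_(m, n)) (x : 'cV[C]_m) :
  x^t* *m (H *m H^t*) *m x = (H^t* *m x)^t* *m (H^t* *m x).
Proof. by rewrite adjmx_mul trmxCK !mulmxA. Qed.

(** If [l > 0], then [v] and the normalised vector [H^t* *m v] form a singular triple of [H] with
    singular value the square root of [l], so the maximality of [s] bounds it. *)
Lemma gram_eigenvalue_le m n (H : 'M[C]_(m, n)) (s : R) (v : 'cV[C]_m) (l : C) :
  largest_singular_value H s -> unit_vector v ->
  H *m H^t* *m v = l *: v -> l <= (s ^+ 2)%:C.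
Proof.
move=> [[_ [_ [s0 _ _ _ _]]] smax] v1 Hv.
have lE : l = ((H^t* *m v)^t* *m (H^t* *m v)) 0 0.
  by rewrite -gram_formE -mulmxA Hv -scalemxAr v1 !mxE eqxx mulr1.
have l0 : 0 <= l.
  by rewrite lE dot_selfE sumr_ge0 // => i _; rewrite exprn_ge0.
have [a la] : exists a : R, l = a%:C by apply/complex_realP; rewrite realE l0.
rewrite la ler0c in l0; rewrite la lecR.
(* For the eigenvalue 0 the vector [H^t* *m v] vanishes and cannot be normalised, so this case is
   separate. *)
have [->|an0] := eqVneq a 0; first exact: sqr_ge0.
have a0 : 0 < a by rewrite lt_def an0.
have sq0 : Num.sqrt a != 0 by rewrite gt_eqF // sqrtr_gt0.
rewrite -(sqr_sqrtr l0) ler_pXn2r ?nnegrE ?sqrtr_ge0 //.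
apply: smax.
exists v, ((Num.sqrt a)^-1%:C *: (H^t* *m v)); split => //.
- rewrite /unit_vector adjmxZ -scalemxAl -scalemxAr scalerA.
  rewrite -gram_formE -mulmxA Hv -scalemxAr v1 scalerA conjC_realc la.
  rewrite -!rmorphM /= -invfM -expr2 sqr_sqrtr // mulVf // scale1r //.
- rewrite -scalemxAr mulmxA Hv scalerA la -rmorphM /=.
  by congr (_%:C *: _); rewrite -[X in _ * X](sqr_sqrtr l0) expr2 mulKf.
- by rewrite scalerA -rmorphM /= mulfV // scale1r.
Qed.

(** In an orthonormal eigenbasis of the Hermitian matrix [H *m H^t*], the quotient at [x] is a
    convex combination of eigenvalues. Each of them is at most [s ^+ 2], which is the value at
    [u]. *)
Lemma top_rayleigh m n (H : 'M[C]_(m, n)) (u x : 'cV[C]_m) :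
  top_left_singular_vector H u -> unit_vector x ->
  (x^t* *m (H *m H^t*) *m x) 0 0 <= (u^t* *m (H *m H^t*) *m u) 0 0.
Proof.
move=> [s [smax [v [s0 u1 v1 Hv Hu]]]] x1.
have -> : (u^t* *m (H *m H^t*) *m u) 0 0 = (s ^+ 2)%:C.
  rewrite -2!mulmxA Hu -scalemxAr Hv -2!scalemxAr u1 !mxE mulr1.
  by rewrite rmorphXn expr2.
set A := H *m H^t*.
have Anormal : A \is normalmx by apply/normalmxP; rewrite adjmx_mul trmxCK.
set P := spectralmx A; set sp := spectral_diag A.
have Pu : P \is unitarymx by exact: spectral_unitarymx.
have PP : P *m P^t* = 1%:M by exact/unitarymxP.
have AE : A = P^t* *m diag_mx sp *m P.
  by rewrite -invmx_unitary //; exact/orthomx_spectralP.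
(* The columns of [P^t*] are unit eigenvectors, so each spectral entry falls under
   [gram_eigenvalue_le]. *)
have sp_le i : sp 0 i <= (s ^+ 2)%:C.
  pose e : 'cV[C]_m := delta_mx i 0.
  apply: (@gram_eigenvalue_le _ _ H s (P^t* *m e)) => //.
    rewrite /unit_vector adjmx_mul trmxCK mulmxA -(mulmxA _ P) PP mulmx1.
    rewrite trmx_delta map_delta_mx mul_delta_mx.
    by apply/matrixP => j k; rewrite !ord1 !mxE.
  rewrite -/A AE -!mulmxA (mulmxA P) PP mul1mx scalemxAr; congr (_ *m _).
  apply/matrixP => j k; rewrite !ord1 mul_diag_mx !mxE.
  by case: eqVneq => [->|]; rewrite ?mulr0.
have y1 : (P *m x)^t* *m (P *m x) = 1%:M.
  by rewrite adjmx_mul mulmxA mulmxKtV.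
have -> : x^t* *m A *m x = (P *m x)^t* *m (diag_mx sp *m (P *m x)).
  by rewrite AE adjmx_mul !mulmxA.
have -> : (s ^+ 2)%:C = (s ^+ 2)%:C * ((P *m x)^t* *m (P *m x)) 0 0.
  by rewrite y1 mxE eqxx mulr1.
move: (P *m x) => y; rewrite dot_selfE mulr_sumr mxE ler_sum // => i _.
rewrite mul_diag_mx !mxE mulrCA [Num.conj _ * _]mulrC -normCK.
by rewrite ler_wpM2r // exprn_ge0.
Qed.

End singular_values.

(** * Continuity of the top singular projector *)

Section matrix_limits.
Context {K : numFieldType} {T : Type} {F : set_system T} {FF : Filter F}.

Definition mx_cvg m n (A : T -> 'M[K]_(m, n)) (A0 : 'M[K]_(m, n)) : Prop :=
  forall i j, A t i j @[t --> F] --> A0 i j.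

Lemma mx_cvg_cst m n (A0 : 'M[K]_(m, n)) : mx_cvg (fun=> A0) A0.
Proof. by move=> i j; exact: cvg_cst. Qed.

Lemma cvg_sum (I : finType) (f : I -> T -> K) (a : I -> K) :
  (forall i, f i t @[t --> F] --> a i) ->
  \sum_i f i t @[t --> F] --> \sum_i a i.
Proof. by move=> fa; apply: cvg_big => //; exact: add_continuous. Qed.

Lemma mx_cvg_mul m n p (A : T -> 'M[K]_(m, n)) A0 (B : T -> 'M[K]_(n, p)) B0 :
  mx_cvg A A0 -> mx_cvg B B0 -> mx_cvg (fun t => A t *m B t) (A0 *m B0).
Proof.
move=> AA BB i j; rewrite mxE.
under eq_fun do rewrite mxE.
by apply: cvg_sum => k; exact: cvgM.
Qed.

Lemma mx_cvg_tr n (A : T -> 'M[K]_n) A0 :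
  mx_cvg A A0 -> \tr (A t) @[t --> F] --> \tr A0.
Proof.
by move=> AA; exact: cvg_sum.
Qed.

Lemma mx_cvg_dist0 m n (A : T -> 'M[K]_(m, n)) A0 : mx_cvg A A0 ->
  \sum_i \sum_j `|(A t - A0) i j| @[t --> F] --> (0 : K).
Proof.
move=> AA; rewrite [X in _ --> X](_ : _ = \sum_(i < m) \sum_(j < n) 0); last first.
  by rewrite big1 // => i _; rewrite big1.
apply: cvg_sum => i; apply: cvg_sum => j; apply/norm_cvg0P.
by under eq_fun do rewrite !mxE; apply/subr_cvg0; exact: AA.
Qed.
End matrix_limits.

Section complex_limits.
Context {R : realType}.
Local Notation C := R[i].
Local Open Scope sesquilinear_scope.
Lemma cvg_realc : (t%:C : C^o) @[t --> (0 : R)] --> (0 : C^o).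
Proof.
apply/cvgr0Pnorm_lt => e e0.
have [r er] : exists r : R, e = r%:C by apply/complex_realP/gtr0_real.
rewrite er ltcR in e0.
near=> t.
rewrite normc_def /= expr0n addr0 sqrtr_sqr er ltcR.
near: t. apply: cvgr0_norm_lt => //. 
Unshelve. all: by end_near. Qed.

Lemma mx_cvg_affine m n (H N : 'M[C]_(m, n)) :
  mx_cvg (F := nbhs (0 : R)) (fun t : R => H + t%:C *: N) H.
Proof.
move=> i j; under eq_fun do rewrite !mxE.
suff : (H i j + t%:C * N i j : C^o) @[t --> (0 : R)] --> (H i j + 0 * N i j : C^o).
  by rewrite mul0r addr0.
apply: cvgD; first exact: cvg_cst.
by apply: cvgM; [exact: cvg_realc | exact: cvg_cst].
Qed.

Lemma unit_vector_tr m (x : 'cV[C]_m) : unit_vector x -> \tr (x *m x^t*) = 1.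
Proof. by move=> x1; rewrite mxtrace_mulC x1 mxtrace1. Qed.

(** The squared Frobenius norm is the trace of the square of the difference: the two projectors
    contribute 1 each, and each of the two cross terms has trace [|p^* u|^2]. *)
Lemma projector_dist m (u p : 'cV[C]_m) : unit_vector u -> unit_vector p ->
  \sum_i \sum_j `|(u *m u^t* - p *m p^t*) i j| ^+ 2 =
  2 * (1 - `|(p^t* *m u) 0 0| ^+ 2).
Proof.
move=> u1 p1; set D := u *m u^t* - p *m p^t*.
have DD : D^t* = D.
  by rewrite /D linearB /= map_mxB !adjmx_mul !trmxCK.
have -> : \sum_i \sum_j `|D i j| ^+ 2 = \tr (D *m D^t*).
  by apply: eq_bigr => i _; rewrite mxE; apply: eq_bigr => j _; rewrite !mxE normCK.
rewrite DD /D mulmxBl !mulmxBr !linearB /=.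
have uu (x : 'cV[C]_m) : unit_vector x -> \tr (x *m x^t* *m (x *m x^t*)) = 1.
  by move=> x1; rewrite mulmxA -(mulmxA x) x1 mulmx1 unit_vector_tr.
have up : \tr (u *m u^t* *m (p *m p^t*)) = `|(p^t* *m u) 0 0| ^+ 2.
  by rewrite -mulmxA mxtrace_mulC trace_mx11 gram_formE dot_selfE big_ord1.
by rewrite !uu // [\tr (p *m _ *m _)]mxtrace_mulC up; ring.
Qed.

Lemma unit_vector_norm m (x : 'cV[C]_m) i : unit_vector x -> `|x i 0| <= 1.
Proof.
move=> x1; rewrite -(@ler_pXn2r _ 2) ?nnegrE // expr1n.
have <- : (x^t* *m x) 0 0 = 1 by rewrite x1 mxE.
by rewrite dot_selfE (bigD1 i) //= lerDl sumr_ge0.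
Qed.

(** Entries of a unit vector have modulus at most 1, so each term of the double sum is dominated by
    the corresponding entry of [E]. *)
Lemma unit_form_le m (E : 'M[C]_m) (x : 'cV[C]_m) : unit_vector x ->
  `|(x^t* *m E *m x) 0 0| <= \sum_i \sum_j `|E i j|.
Proof.
move=> x1; rewrite -mulmxA mxE (le_trans (ler_norm_sum _ _ _)) // ler_sum // => i _.
rewrite !mxE mulr_sumr (le_trans (ler_norm_sum _ _ _)) // ler_sum // => j _.
rewrite !normrM norm_conjC mulrCA ler_piMr //.
by rewrite mulr_ile1 // unit_vector_norm.
Qed.

(** Write [A t = A0 + E] and [q = p^* u]. Comparing the forms at [p] and at [u t] gives
    [mu (1 - |q|^2) <= u^* E u - p^* E p], and [1 - |q|^2] controls the distance of the projectors.
    The vectors [u t] themselves need not converge, their phases being arbitrary. *)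
Lemma top_projector_cvg {T : Type} {F : set_system T} {FF : Filter F} m
    (A : T -> 'M[C]_m) (A0 : 'M[C]_m) (u : T -> 'cV[C]_m) (p : 'cV[C]_m) (mu : C) :
  0 < mu -> unit_vector p -> A0 = mu *: (p *m p^t*) ->
  mx_cvg (F := F) A A0 -> (forall t, unit_vector (u t)) ->
  (forall t, (p^t* *m A t *m p) 0 0 <= ((u t)^t* *m A t *m u t) 0 0) ->
  mx_cvg (F := F) (fun t => u t *m (u t)^t*) (p *m p^t*).
Proof.
move=> mu0 p1 A0E AA0 u1 Au.
(* The constant 4 is the factor 2 of [projector_dist] times the two error terms, at [u t] and at
   [p]; [mu] is the spectral gap of [A0]. *)
pose g t : C := 4 / mu * \sum_i \sum_j `|(A t - A0) i j|.
have g0 : (g t : C^o) @[t --> F] --> (0 : C^o).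
  suff : (g t : C^o) @[t --> F] --> (4 / mu * 0 : C^o) by rewrite mulr0.
  rewrite /g; apply: (cvgM (K := C)); first exact: cvg_cst.
  exact: (mx_cvg_dist0 (K := C)).
have le_g t i j : `|(u t *m (u t)^t* - p *m p^t*) i j| ^+ 2 <= g t.
  have -> : g t = 2 / mu * (\sum_i \sum_j `|(A t - A0) i j| +
      \sum_i \sum_j `|(A t - A0) i j|).
    by rewrite /g; set S := \sum_i _; ring.
  set q := (p^t* *m u t) 0 0.
  have sum_le : `|(u t *m (u t)^t* - p *m p^t*) i j| ^+ 2 <= 2 * (1 - `|q| ^+ 2).
    rewrite -projector_dist // (bigD1 i) //= (bigD1 j) //= -addrA lerDl.
    by rewrite addr_ge0 // !sumr_ge0 // => k _; rewrite ?sumr_ge0 // => *;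
      rewrite exprn_ge0.
  apply: (le_trans sum_le); rewrite -mulrA ler_pM2l // mulrC ler_pdivlMr // mulrC.
  set E := A t - A0.
  have AE : A t = A0 + E by rewrite /E addrC subrK.
  clearbody E.
  have uA0 : ((u t)^t* *m A0 *m u t) 0 0 = mu * `|q| ^+ 2.
    by rewrite A0E -scalemxAr -scalemxAl mxE gram_formE dot_selfE big_ord1.
  have pA0 : (p^t* *m A0 *m p) 0 0 = mu.
    by rewrite A0E -scalemxAr -scalemxAl mulmxA p1 mul1mx p1 !mxE mulr1.
  have addE (X Y : 'M[C]_1) : (X + Y) 0 0 = X 0 0 + Y 0 0 by rewrite mxE.
  have := Au t; rewrite AE !mulmxDr !mulmxDl !addE uA0 pA0.
  set a := (_ *m E *m p) 0 0; set b := (_ *m E *m u t) 0 0 => ab.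
  have q1 : 0 <= mu * (1 - `|q| ^+ 2).
    rewrite pmulr_rge0 // -(@pmulr_rge0 _ 2) //.
    by apply: le_trans sum_le; rewrite exprn_ge0.
  have ba : mu * (1 - `|q| ^+ 2) <= b - a.
    by rewrite mulrBr mulr1 lerBlDr addrAC lerBrDr [X in _ <= X]addrC.
  apply: (le_trans ba); rewrite -[b - a]ger0_norm ?(le_trans q1) //.
  by rewrite (le_trans (ler_normB _ _)) // lerD // unit_form_le.
move=> i j; apply/cvgrPdist_lt => e e0.
have e20 : 0 < e ^+ 2 by rewrite exprn_gt0.
move/cvgr0Pnorm_lt/(_ _ e20) : g0; apply: filterS => t gt.
rewrite distrC -(@ltr_pXn2r _ 2) ?nnegrE // ?(ltW e0) //.
apply: le_lt_trans gt.
have := le_g t i j; rewrite !mxE => /le_trans; apply.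
rewrite real_ler_norm // realE.
by rewrite (le_trans _ (le_g t i j)) // exprn_ge0.
Qed.

End complex_limits.

(** * First-order expansion of the pole estimate *)

Section pole.
Context {R : realType}.
Local Notation C := R[i].
Local Open Scope sesquilinear_scope.

Lemma mxtrace_form m (A : 'M[C]_m) (u : 'cV[C]_m) :
  \tr (A *m (u *m u^t*)) = (u^t* *m A *m u) 0 0.
Proof. by rewrite mulmxA mxtrace_mulC mulmxA trace_mx11. Qed.

Lemma moore_penrose_row n (x : 'rV[C]_n) : (x *m x^t*) 0 0 != 0 ->
  moore_penrose x = ((x *m x^t*) 0 0)^-1 *: x^t*.
Proof.
set c := (x *m x^t*) 0 0 => c0.
have xx : x *m x^t* = c%:M by rewrite [LHS]mx11_scalar.
have x0 : x != 0 by apply: contra_neq c0; rewrite /c => ->; rewrite mul0mx mxE.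
have cR : c \is Num.real.
  apply/ger0_real; rewrite /c mxE sumr_ge0 // => i _.
  by rewrite !mxE -normCK exprn_ge0.
have ex : is_moore_penrose x (c^-1 *: x^t*).
  have xX : x *m (c^-1 *: x^t*) = 1%:M.
    by rewrite -scalemxAr xx scale_scalar_mx mulVf.
  split.
  - by rewrite xX mul1mx.
  - by rewrite -mulmxA xX mulmx1.
  - by rewrite xX trmx1 map_mx1.
  - by rewrite -scalemxAl adjmxZ adjmx_mul trmxCK conj_Creal ?rpredV.
(* Since one solution exists, the chosen matrix satisfies the Penrose equations; it remains to see
   that these determine it. *)
have := xgetPex 0 (ex_intro (fun X => is_moore_penrose x X) _ ex).
rewrite -/(moore_penrose x); move: (moore_penrose x) => X [xXx XxX _ Xx].
have xX : x *m X = 1%:M.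
  move: xXx; rewrite [x *m X]mx11_scalar mul_scalar_mx => /eqP.
  rewrite -subr_eq0 -[X in _ - X]scale1r -scalerBl scaler_eq0 (negbTE x0) orbF.
  by rewrite subr_eq0 => /eqP ->.
(* As [X *m x] is Hermitian, [X = X x X = x^* X^* X], which makes [X] a multiple of [x^t*]; the
   scalar then follows from [x *m X = 1]. *)
have XE : X = (X^t* *m X) 0 0 *: x^t*.
  rewrite -[LHS]XxX -Xx adjmx_mul -mulmxA.
  by rewrite [Y in _ *m Y = _]mx11_scalar mul_mx_scalar.
move: XE xX; move: (_ 0 0) => g ->; rewrite -scalemxAr xx scale_scalar_mx.
move/matrixP/(_ 0 0); rewrite !mxE !eqxx !mulr1n => h.
by congr (_ *: _); apply: (mulIf c0); rewrite h mulVf.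
Qed.

(** Only the projector [Q] enters this form, so the phase of the singular vector disappears and
    convergence of [Q] is enough for limits. *)
Lemma mp_pole_traceE K M (u : 'rV[C]_K -> 'cV[C]_M) (h : 'rV[C]_K) :
  let H0 := hankel0 M h in let H1 := hankel1 M h in
  let Q := u h *m (u h)^t* in
  \tr (H0 *m H0^t* *m Q) != 0 ->
  mp_pole u h = \tr (H1 *m H0^t* *m Q) / \tr (H0 *m H0^t* *m Q).
Proof.
rewrite /= !mxtrace_form /mp_pole => d0.
set H0 := hankel0 M h in d0 *; set H1 := hankel1 M h; set x := (u h)^t* *m H0.
have xx : x *m x^t* = (u h)^t* *m (H0 *m H0^t*) *m u h.
  by rewrite /x adjmx_mul trmxCK !mulmxA.
rewrite moore_penrose_row xx // -scalemxAr mxE mulrC; congr (_ / _).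
by rewrite /x adjmx_mul trmxCK !mulmxA.
Qed.

Lemma hankel0D K M (g h : 'rV[C]_K) :
  hankel0 M (g + h) = hankel0 M g + hankel0 M h.
Proof. by apply/matrixP => i j; rewrite !mxE. Qed.

Lemma hankel1D K M (g h : 'rV[C]_K) :
  hankel1 M (g + h) = hankel1 M g + hankel1 M h.
Proof. by apply/matrixP => i j; rewrite !mxE. Qed.

Lemma hankel0Z K M a (h : 'rV[C]_K) : hankel0 M (a *: h) = a *: hankel0 M h.
Proof. by apply/matrixP => i j; rewrite !mxE. Qed.

Lemma hankel1Z K M a (h : 'rV[C]_K) : hankel1 M (a *: h) = a *: hankel1 M h.
Proof. by apply/matrixP => i j; rewrite !mxE. Qed.

Definition steering m (z : C) : 'cV[C]_m := \col_(i < m) z ^+ i.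

Lemma hankel0_los K M (beta z : C) :
  hankel0 M (los_response K beta z) =
  beta *: (steering M z *m (steering (K - M) z)^T).
Proof.
apply/matrixP => i j; rewrite !mxE big_ord1 !mxE /= exprD //.
Qed.

Lemma hankel1_los K M (beta z : C) :
  hankel1 M (los_response K beta z) = z *: hankel0 M (los_response K beta z).
Proof. by apply/matrixP => i j; rewrite !mxE /= exprS mulrCA. Qed.

Lemma steering_dot m (z : C) : `|z| = 1 ->
  (steering m z)^t* *m steering m z = m%:R%:M.
Proof.
move=> z1; rewrite [LHS]mx11_scalar dot_selfE; congr (_%:M).
under eq_bigr do rewrite mxE normrX z1 !expr1n.
by rewrite sumr_const card_ord.
Qed.

Lemma steering_dotT m (z : C) : `|z| = 1 ->
  (steering m z)^T *m ((steering m z)^T)^t* = m%:R%:M.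
Proof.
move=> z1; rewrite -(steering_dot m z1) [LHS]mx11_scalar [RHS]mx11_scalar.
by congr (_%:M); rewrite !mxE; apply: eq_bigr => i _; rewrite !mxE mulrC.
Qed.

Lemma hankel0_observation K M (beta z : C) w t :
  hankel0 M (observation beta z w t) =
  hankel0 M (los_response K beta z) + t%:C *: hankel0 M (\row_(k < K) w k).
Proof. by rewrite hankel0D hankel0Z. Qed.

Lemma hankel1_observation K M (beta z : C) w t :
  hankel1 M (observation beta z w t) = z *: hankel0 M (observation beta z w t) +
  t%:C *: (hankel1 M (\row_(k < K) w k) - z *: hankel0 M (\row_(k < K) w k)).
Proof.
rewrite hankel0_observation hankel1D hankel1Z hankel1_los scalerDr scalerBr.
by rewrite !scalerA [z * _]mulrC -addrA; congr (_ + _); rewrite addrCA subrr addr0.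
Qed.

(** Since [H1 = z H0 + t Dw] along the noise, the trace quotient is exactly [z] plus [t] times a
    quotient that has a limit. The limit of this slope is all that the derivative at 0 requires. *)
Lemma mp_pole_expansion K M (beta z : C) (w : 'I_K -> C)
    (u : 'rV[C]_K -> 'cV[C]_M) :
  (0 < M)%N -> (M < K)%N -> beta != 0 -> `|z| = 1 -> svd_choice u ->
  let Dw := hankel1 M (\row_(k < K) w k) - z *: hankel0 M (\row_(k < K) w k) in
  let y0 := ((steering M z)^t* *m Dw *m ((steering (K - M) z)^T)^t*) 0 0 /
            (beta * (M * (K - M))%:R) in
  exists2 y : R -> C, (y t : C^o) @[t --> (0 : R)] --> (y0 : C^o) &
    \forall t \near (0 : R),
      mp_pole u (observation beta z w t) = z + t%:C * y t.
Proof.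
move=> M0 MK b0 z1 hu Dw y0.
pose a := steering M z; pose b := steering (K - M) z.
set N0 := hankel0 M (\row_(k < K) w k) in Dw y0 *.
pose H : 'M[C]_(M, K - M) := beta *: (a *m b^T).
pose Ht t := H + t%:C *: N0.
have HtE t : hankel0 M (observation beta z w t) = Ht t.
  by rewrite hankel0_observation hankel0_los.
(* The entries of [a] have modulus 1, so its squared norm is [M]; [p] is the noiseless top left
   singular vector. *)
pose p : 'cV[C]_M := (Num.sqrt M%:R)^-1%:C *: a.
have Mn0 : (M%:R : C) != 0 by rewrite pnatr_eq0 -lt0n.
have Gn0 : ((K - M)%:R : C) != 0 by rewrite pnatr_eq0 -lt0n subn_gt0.
have ppE : p *m p^t* = M%:R^-1 *: (a *m a^t*).
  rewrite /p adjmxZ -scalemxAl -scalemxAr scalerA conjC_realc -rmorphM /=.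
  rewrite -invfM -expr2 sqr_sqrtr ?ler0n // rmorphV ?unitfE ?pnatr_eq0 -?lt0n //.
  by rewrite /= rmorph_nat.
have p1 : unit_vector p.
  rewrite /unit_vector /p adjmxZ -scalemxAl -scalemxAr scalerA conjC_realc -rmorphM /=.
  rewrite -invfM -expr2 sqr_sqrtr ?ler0n // rmorphV ?unitfE ?pnatr_eq0 -?lt0n //.
  rewrite /= rmorph_nat.
  by rewrite steering_dot // scale_scalar_mx mulVf.
(* The only nonzero eigenvalue of the noiseless [H *m H^t*]: the squared norms of [a] and [b] are
   [M] and [K - M]. *)
pose mu : C := `|beta| ^+ 2 * (K - M)%:R * M%:R.
have mu0 : 0 < mu.
  by rewrite !mulr_gt0 ?exprn_gt0 ?normr_gt0 // ltr0n ?subn_gt0.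
have HHE : H *m H^t* = mu *: (p *m p^t*).
  rewrite ppE /H adjmxZ adjmx_mul -scalemxAl -scalemxAr scalerA -normCK.
  rewrite mulmxA -(mulmxA a) steering_dotT // mul_mx_scalar -scalemxAl !scalerA.
  by congr (_ *: _); rewrite /mu mulfK.
pose A t := Ht t *m (Ht t)^t*.
pose Q t := u (observation beta z w t) *m (u (observation beta z w t))^t*.
have Ht_cvg : mx_cvg (F := nbhs (0 : R)) Ht H by exact: mx_cvg_affine.
have Hadj_cvg : mx_cvg (F := nbhs (0 : R)) (fun t => (Ht t)^t*) (H^t*).
  have -> : (fun t => (Ht t)^t*) = (fun t => H^t* + t%:C *: N0^t*).
    by apply/funext => t; rewrite /Ht linearD /= map_mxD (adjmxZ t%:C) conjC_realc.
  exact: mx_cvg_affine.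
have A_cvg : mx_cvg (F := nbhs (0 : R)) A (H *m H^t*) by exact: mx_cvg_mul.
have u1 t : unit_vector (u (observation beta z w t)).
  by have [s [_ [v [_ u1 _ _ _]]]] := hu (observation beta z w t).
have Q_cvg : mx_cvg (F := nbhs (0 : R)) Q (p *m p^t*).
  apply: (top_projector_cvg (u := fun t => u (observation beta z w t)) (A := A)
    mu0 p1 HHE) => // t.
  rewrite /A -HtE. exact: top_rayleigh. 
pose den t := \tr (A t *m Q t).
have den_cvg : (den t : C^o) @[t --> (0 : R)] --> (mu : C^o).
  have <- : \tr (H *m H^t* *m (p *m p^t*)) = mu.
    rewrite HHE -scalemxAl mulmxA -(mulmxA p) p1 mulmx1 linearZ /=.
    by rewrite unit_vector_tr // mulr1.
  apply: (mx_cvg_tr (K := C)). exact: (mx_cvg_mul A_cvg Q_cvg). 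
exists (fun t => \tr (Dw *m (Ht t)^t* *m Q t) / den t).
  have -> : y0 = \tr (Dw *m H^t* *m (p *m p^t*)) / mu.
    rewrite ppE /H adjmxZ adjmx_mul /y0 -!scalemxAr -scalemxAl !linearZ /=.
    have -> : \tr (Dw *m ((b^T)^t* *m a^t*) *m (a *m a^t*)) =
        M%:R * (a^t* *m Dw *m (b^T)^t*) 0 0.
      rewrite !mulmxA -(mulmxA _ (a^t*) a) steering_dot // mul_mx_scalar.
      rewrite -scalemxAl linearZ /=.
      by rewrite -trace_mx11 -[a^t* *m _ *m _]mulmxA [in RHS]mxtrace_mulC.
    (* The conjugate of [beta] coming from [H^t*] cancels against [|beta|^2] in [mu], which leaves
       [1 / beta]. *)
    have cb0 : Num.conj beta != 0 by rewrite conjC_eq0.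
    rewrite /mu normCK natrM; set x := (_ *m _ *m _) 0 0; field.
    by rewrite Mn0 Gn0 b0 cb0.
  apply: (cvgM (K := C)).
    apply: (mx_cvg_tr (K := C)).
    have Dw_cvg : mx_cvg (F := nbhs (0 : R)) (fun=> Dw) Dw by exact: mx_cvg_cst.
    exact: (mx_cvg_mul (mx_cvg_mul Dw_cvg Hadj_cvg) Q_cvg).
  by apply: (cvgV (K := C)) => //; rewrite gt_eqF.
(* The denominator tends to [mu], which is nonzero, so the trace formula for the pole applies for
   all [t] near 0. *)
have mun : 0 < `|mu| by rewrite normr_gt0 gt_eqF.
have near_den := cvgr_norm_gt _ den_cvg _ mun.
near=> t; have dent : den t != 0 by rewrite -normr_gt0; near: t; exact: near_den.
have dE : \tr (hankel0 M (observation beta z w t) *m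
  (hankel0 M (observation beta z w t))^t* *m Q t) = den t by rewrite HtE.
rewrite mp_pole_traceE -/(Q t) dE // hankel1_observation HtE.
rewrite -/N0 -/Dw 2!mulmxDl -!scalemxAl mxtraceD !mxtraceZ -/(den t) -/(A t).
by rewrite mulrDl mulfK // mulrA.
Unshelve. all: by end_near. Qed.
End pole.

(** * Derivative of the argument *)

Section phase.
Context {R : realType}.
Local Notation C := R[i].

Lemma expiD (a b : R) : expi (a + b) = expi a * expi b.
Proof. by rewrite /expi cosD sinD [sin a * _ + _]addrC. Qed.

Lemma modulusE (z : C) : `|z| = (modulus z)%:C.
Proof. exact: normc_def. Qed.

Lemma norm_expi (a : R) : `|expi a| = 1.
Proof. by rewrite normc_def /= cos2Dsin2 sqrtr1. Qed.

Lemma conj_expi (a : R) : Num.conj (expi a) = expi (- a).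
Proof. by rewrite /expi cosN sinN. Qed.

Lemma normc_ge_Im (x : C) : `|complex.Im x|%:C <= `|x|.
Proof.
rewrite -[complex.Im x]opprK -ReiNIm normrN; apply: (le_trans (normc_ge_Re _)).
by rewrite normrM [X in _ * X]normc_def /= expr0n expr1n add0r sqrtr1 mulr1.
Qed.

Lemma cvg_Re_Im (T : Type) (F : set_system T) (FF : Filter F) (f : T -> C) (l : C) :
  (f t : C^o) @[t --> F] --> (l : C^o) ->
  complex.Re (f t) @[t --> F] --> complex.Re l /\
  complex.Im (f t) @[t --> F] --> complex.Im l.
Proof.
move=> /cvgrPdist_lt fl; split; apply/cvgrPdist_lt => e e0.
  have ec0 : (0 : C) < e%:C by rewrite ltcR.
  move: (fl _ ec0); apply: filterS => t; rewrite -ltcR; apply: le_lt_trans.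
  by rewrite -raddfB; exact: normc_ge_Re.
have ec0 : (0 : C) < e%:C by rewrite ltcR.
move: (fl _ ec0); apply: filterS => t; rewrite -ltcR; apply: le_lt_trans.
by rewrite -raddfB; exact: normc_ge_Im.
Qed.

(** Away from 0 the difference quotient of [t * q t] is [q] itself, so a limit of [q] suffices and
    no derivative of [q] is taken. *)
Lemma is_derive_slope (q : R -> R) (l : R) : q t @[t --> (0 : R)] --> l ->
  is_derive (0 : R) (1 : R) (fun t => t * q t : R^o) l.
Proof.
move=> ql.
have : (fun h : R => h^-1 *: (((fun t => t * q t : R^o) \o shift 0) (h *: (1 : R))
    - (0 * q 0 : R^o))) @ 0^' --> (l : R^o).
  apply: cvg_trans (cvg_within_filter _ ql); apply: near_eq_cvg.
  near=> h.
  have h0 : h != 0 by near: h; exact: nbhs_dnbhs_neq.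
  by rewrite /= /shift /= mul0r subr0 addr0 [h *: 1]mulr1 [_ *: _]mulrA mulVf // mul1r.
move=> h; apply: DeriveDef; first by apply/cvg_ex; exists l.
exact: cvg_lim h.
Unshelve. all: by end_near. Qed.

(** Rotating [f t] by the conjugate of [z] gives [1 + t x(t)], whose argument is the increment of
    [arg]. Near 0 this increment is the arctangent of imaginary part over real part. *)
Lemma arg_is_derive (arg : C -> R) (z y0 : C) (f y : R -> C) :
  `|z| = 1 -> arg_branch_near arg z ->
  (y t : C^o) @[t --> (0 : R)] --> (y0 : C^o) ->
  (\forall t \near (0 : R), f t = z + t%:C * y t) ->
  is_derive (0 : R) (1 : R) (fun t => arg (f t) : R^o) (complex.Im (Num.conj z * y0)).
Proof.
move=> z1 harg yy0 fE.
have [/= zE argc] := nbhs_singleton harg.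
have m1 : modulus z = 1 by apply: complexI; rewrite -modulusE z1.
rewrite m1 mul1r in zE.
have zz : Num.conj z * z = 1 by rewrite mulrC -normCK z1 expr1n.
have f_cvg : (f t : C^o) @[t --> (0 : R)] --> (z : C^o).
  have : (z + t%:C * y t : C^o) @[t --> (0 : R)] --> (z + 0 * y0 : C^o).
    apply: cvgD; first exact: cvg_cst.
    by apply: (cvgM (K := C)); [exact: cvg_realc | exact: yy0].
  rewrite mul0r addr0; apply: cvg_trans; apply: near_eq_cvg.
  by near=> t; rewrite (near fE t).
pose x t := Num.conj z * y t; pose x0 := Num.conj z * y0.
have x_cvg : (x t : C^o) @[t --> (0 : R)] --> (x0 : C^o).
  by apply: (cvgM (K := C)); [exact: cvg_cst | exact: yy0].
have [Re_cvg Im_cvg] := cvg_Re_Im _ x_cvg.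
pose d t := 1 + t * complex.Re (x t).
have d_cvg : d t @[t --> (0 : R)] --> (1 : R).
  have : d t @[t --> (0 : R)] --> 1 + 0 * complex.Re x0.
    by apply: cvgD; [exact: cvg_cst | apply: cvgM].
  by rewrite mul0r addr0.
pose q t := complex.Im (x t) / d t.
have q_cvg : q t @[t --> (0 : R)] --> complex.Im x0.
  have : q t @[t --> (0 : R)] --> complex.Im x0 / 1.
    by apply: cvgM => //; apply: cvgV => //; exact: oner_neq0.
  by rewrite divr1.
have arg_cvg : arg (f t) @[t --> (0 : R)] --> arg z.
  exact: (cvg_comp _ _ f_cvg argc).
have near_branch : \forall t \near (0 : R),
    f t = (modulus (f t))%:C * expi (arg (f t)).
  by apply: (@filterS _ (nbhs (0 : R)) _ _ _ _ (f_cvg _ harg)) => t /= [].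
have near_d : \forall t \near (0 : R), 0 < d t.
  exact: (cvgr_gt _ d_cvg _ ltr01).
(* Continuity of the branch keeps the increment in the interval where [atan] inverts [tan], so no
   multiple of pi can intervene. *)
have near_arg : \forall t \near (0 : R), `|arg z - arg (f t)| < pi / 2.
  by move/cvgrPdist_lt : arg_cvg; apply; rewrite divr_gt0 ?pi_gt0.
apply: (@near_eq_is_derive R R^o R^o (fun t : R => arg z + atan (t * q t))).
  near=> t.
  have dt : 0 < d t by near: t.
  have argt : `|arg z - arg (f t)| < pi / 2 by near: t.
  have bt : f t = (modulus (f t))%:C * expi (arg (f t)) by near: t.
  have ft : f t = z + t%:C * y t by near: t.
  pose phi := arg (f t) - arg z.
  have : (modulus (f t))%:C * expi phi = 1 + t%:C * x t.
    rewrite /phi expiD -conj_expi -zE mulrA -bt ft /x -zz; ring.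
  move=> /[dup] /(congr1 (@complex.Re R)) + /(congr1 (@complex.Im R)).
  have -> : complex.Re (1 + t%:C * x t) = d t.
    by rewrite /d; case: (x t) => a b /=; rewrite mul0r subr0.
  have -> : complex.Im (1 + t%:C * x t) = t * complex.Im (x t).
    by case: (x t) => a b /=; rewrite mul0r addr0 add0r.
  rewrite /= !mul0r subr0 addr0 => mc ms.
  have mc0 : modulus (f t) * cos phi != 0 by rewrite mc gt_eqF.
  move: (mc0); rewrite mulf_eq0 negb_or => /andP[m0 c0].
  have -> : t * q t = tan phi.
    by rewrite /q mulrA -ms -mc /tan -mulf_div divff // mul1r.
  have -> : atan (tan phi) = phi by rewrite tanK // in_itv /= -ltr_norml /phi distrC.
  by rewrite /phi [RHS](_ : _ = arg z + (arg (f t) - arg z)) // addrC subrK.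
rewrite -[complex.Im _]add0r; apply: is_deriveD.
have gd := is_derive_slope q_cvg.
have hd := @is_derive1_comp R (@atan R) (fun t => t * q t) 0 _ _ (is_derive1_atan _) gd.
apply: is_derive_eq.
by rewrite mul0r expr0n addr0 invr1 mul1r.
Unshelve. all: by end_near. Qed.
End phase.

(** * Second moments of circularly symmetric noise *)

Section second_order.
Context d (T : measurableType d) (R : realType) (P : probability T R).
Local Notation C := R[i].

(** Nonnegative functions are integrated against equal pushforward measures. In general both
    integrals are the same difference of positive and negative parts, so no integrability is
    required. *)
Lemma integral_eq_law d' (Y : measurableType d') (phi psi : T -> Y)
    (f : Y -> \bar R) :
  measurable_fun [set: T] phi -> measurable_fun [set: T] psi ->
  (forall B, measurable B -> P (phi @^-1` B) = P (psi @^-1` B)) ->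
  measurable_fun [set: Y] f ->
  (\int[P]_x f (phi x) = \int[P]_x f (psi x))%E.
Proof.
move=> mphi mpsi law mf.
have ge0_eq (g : Y -> \bar R) : measurable_fun [set: Y] g ->
    (forall y, 0 <= g y)%E -> (\int[P]_x (g \o phi) x = \int[P]_x (g \o psi) x)%E.
  move=> mg g0.
  have push (h : T -> Y) : measurable_fun [set: T] h ->
      (\int[P]_x (g \o h) x = \int[pushforward P h]_y g y)%E.
    by move=> mh; rewrite ge0_integral_pushforward // preimage_setT.
  rewrite !push //.
  by apply: eq_measure_integral => B mB _; exact: law.
have splitE (h : T -> Y) : (\int[P]_x f (h x) =
    \int[P]_x ((f^\+)%E \o h) x - \int[P]_x ((f^\-)%E \o h) x)%E.
  by rewrite [LHS]integralE -funepos_comp -funeneg_comp.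
rewrite !splitE (ge0_eq (f^\+)%E) ?(ge0_eq (f^\-)%E) //.
- exact: measurable_funeneg.
- exact: measurable_funepos.
Qed.

(** Serves to turn the invariance of a law under a sign change into the vanishing of means and cross
    moments. *)
Lemma integrable_odd_eq0 (f : T -> R) :
  P.-integrable [set: T] (EFin \o f) ->
  (\int[P]_x (f x)%:E = \int[P]_x (- f x)%:E)%E -> (\int[P]_x (f x)%:E = 0)%E.
Proof.
move=> intf; under [in RHS]eq_integral do rewrite EFinN.
rewrite integralN; last first.
  by apply: fin_num_adde_defl; rewrite fin_numN; exact: integrable_neg_fin_num.
move: (integrable_fin_num measurableT intf) => /=.
case: (\int[P]_x _)%E => // r _ /eqP; rewrite eqe => /eqP rN.
by congr (_%:E); lra.
Qed.

Lemma Lfun2_sqr (f : T -> R) : measurable_fun [set: T] f ->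
  (\int[P]_x (f x ^+ 2)%:E < +oo)%E -> f \in Lfun P 2%:E.
Proof.
move=> mf f2; rewrite inE; apply/andP; split; first by rewrite inE.
rewrite inE /= /finite_norm unlock /=; apply: poweR_lty.
rewrite (eq_integral (fun x => (f x ^+ 2)%:E)) // => x _.
by rewrite /= powR_mulrn // real_normK // num_real.
Qed.

Lemma variance_sum_uncorrelated (I : eqType) (s : seq I) (X : I -> T -> R) :
  uniq s -> (forall i, X i \in Lfun P 2%:E) ->
  (forall i j, i != j -> covariance P (X i) (X j) = 0%E) ->
  ('V_P[(\sum_(i <- s) X i)%R] = \sum_(i <- s) 'V_P[X i])%E.
Proof.
move=> us X2 cov0; have l12 : (1 <= 2%:E :> \bar R)%E by rewrite lee_fin ler1n.
have cov_sum i r : i \notin r -> covariance P (X i) (\sum_(j <- r) X j) = 0%E.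
  elim: r => [_|j r IH]; first by rewrite big_nil covariance_cst_r.
  rewrite inE negb_or => /andP[ij ir].
  rewrite big_cons covarianceDr ?rpred_sum // cov0 // IH // adde0 //.
elim: s us => [_|i s IH /=]; first by rewrite !big_nil variance_cst.
move=> /andP[i_s us]; rewrite !big_cons varianceD ?rpred_sum //.
by rewrite IH // cov_sum // mule0 adde0.
Qed.

(** Measurable rectangles are stable under intersection and generate the product sigma-algebra, so
    they determine a finite measure. *)
Lemma law_prod_rect (d1 d2 : measure_display) (Y1 : measurableType d1)
    (Y2 : measurableType d2) (phi psi : T -> Y1 * Y2) :
  measurable_fun [set: T] phi -> measurable_fun [set: T] psi ->
  (forall B1 B2, measurable B1 -> measurable B2 ->
     P (phi @^-1` (B1 `*` B2)) = P (psi @^-1` (B1 `*` B2))) ->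
  forall B, measurable B -> P (phi @^-1` B) = P (psi @^-1` B).
Proof.
move=> mphi mpsi rect B mB.
pose G := [set A `*` B | A in @measurable _ Y1 & B in @measurable _ Y2].
rewrite -[LHS]/(pushforward P phi B) -[RHS]/(pushforward P psi B).
apply: (measure_unique G (fun=> setT)) => //.
- exact: measurable_prod_measurableType.
- move=> _ _ [A1 mA1 [A2 mA2 <-]] [B1 mB1 [B2 mB2 <-]].
  exists (A1 `&` B1); first exact: measurableI.
  exists (A2 `&` B2); first exact: measurableI.
  by rewrite setXI.
- by move=> _; exists setT => //; exists setT => //; rewrite setXTT.
- by rewrite bigcup_const //; exists 0%N.
- by move=> _ [A1 mA1 [A2 mA2 <-]]; exact: rect.
- by move=> _; rewrite /= /pushforward preimage_setT probability_setT ltry.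
Qed.

(** Inverse of [real_pair]: it turns functions of a complex sample into functions on [R * R], where
    measurability makes sense. *)
Definition of_pair (x : R * R) : C := x.1 +i* x.2.

Lemma of_pairK (z : C) : of_pair (real_pair z) = z.
Proof. by case: z. Qed.

Lemma measurable_ReM (g : C) :
  measurable_fun [set: R * R] (fun x => complex.Re (g * of_pair x)).
Proof.
case: g => a b.
apply: (@eq_measurable_fun _ _ _ _ _ (fun x : R * R => a * x.1 - b * x.2)) => //.
by apply: measurable_funB; apply: measurable_funM.
Qed.

Lemma measurable_ImM (g : C) :
  measurable_fun [set: R * R] (fun x => complex.Im (g * of_pair x)).
Proof.
case: g => a b.
apply: (@eq_measurable_fun _ _ _ _ _ (fun x : R * R => a * x.2 + b * x.1)) => //.
by apply: measurable_funD; apply: measurable_funM.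
Qed.

Lemma measurable_expiM (theta : R) :
  measurable_fun [set: R * R] (fun x => real_pair (expi theta * of_pair x)).
Proof.
by apply: measurable_fun_pair; [exact: measurable_ReM | exact: measurable_ImM].
Qed.

Lemma modulus_sqr (z : C) : modulus z ^+ 2 = complex.Re z ^+ 2 + complex.Im z ^+ 2.
Proof. by rewrite sqr_sqrtr // addr_ge0 // sqr_ge0. Qed.

Lemma modulusM (z1 z2 : C) : modulus (z1 * z2) = modulus z1 * modulus z2.
Proof. by apply: complexI; rewrite rmorphM /= -!modulusE normrM. Qed.

Lemma expi_pihalf : expi (pi / 2) = 'i%C :> C.
Proof. by rewrite /expi cos_pihalf sin_pihalf. Qed.

Lemma expi_pi : expi pi = -1 :> C.
Proof. by rewrite /expi cospi sinpi; apply/eqP; rewrite eq_complex /= oppr0 !eqxx. Qed.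

Section noise.
Context (sigma2 : R) (I : finType) (w : I -> T -> C) (hw : iid_cscg P sigma2 w).

Lemma noise_measurable i : measurable_fun [set: T] (fun o => real_pair (w i o)).
Proof. by case: hw => h _ _ _; exact: h. Qed.

Lemma noise_ImM_measurable g i :
  measurable_fun [set: T] (fun o => complex.Im (g * w i o)).
Proof.
have := measurableT_comp (measurable_ImM g) (noise_measurable i).
by apply: eq_measurable_fun => o _ /=; rewrite of_pairK.
Qed.

Lemma noise_ReM_measurable g i :
  measurable_fun [set: T] (fun o => complex.Re (g * w i o)).
Proof.
have := measurableT_comp (measurable_ReM g) (noise_measurable i).
by apply: eq_measurable_fun => o _ /=; rewrite of_pairK.
Qed.

Lemma noise_rot_measurable theta i :
  measurable_fun [set: T] (fun o => real_pair (expi theta * w i o)).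
Proof.
have := measurableT_comp (measurable_expiM theta) (noise_measurable i).
by apply: eq_measurable_fun => o _ /=; rewrite of_pairK.
Qed.

Lemma noise_rot_law theta i (B : set (R * R)) : measurable B ->
  P ((fun o => real_pair (expi theta * w i o)) @^-1` B) =
  P ((fun o => real_pair (w i o)) @^-1` B).
Proof. by case: hw => _ _ _ /(_ i)[_ + _ _]; exact. Qed.

(** A quarter turn preserves the law of [w i] and exchanges real and imaginary parts up to sign. The
    two second moments are thus equal, and they add up to [|g|^2 sigma2]. *)
Lemma noise_Im_sqr g i :
  (\int[P]_o (complex.Im (g * w i o) ^+ 2)%:E =
   (modulus g ^+ 2 * sigma2 / 2)%:E)%E.
Proof.
have ReIm : (\int[P]_o (complex.Re (g * w i o) ^+ 2)%:E =
    \int[P]_o (complex.Im (g * w i o) ^+ 2)%:E)%E.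
  pose f (x : R * R) := (complex.Re (g * of_pair x) ^+ 2)%:E.
  transitivity (\int[P]_o f (real_pair (expi (pi / 2) * w i o)%R))%E; last first.
    apply: eq_integral => o _.
    by rewrite /f of_pairK expi_pihalf mulrCA mulrC ReiNIm sqrrN.
  transitivity (\int[P]_o f (real_pair (w i o)))%E.
    by apply: eq_integral => o _; rewrite /f of_pairK.
  apply: integral_eq_law.
  - exact: noise_measurable.
  - exact: noise_rot_measurable.
  - by move=> B mB; rewrite noise_rot_law.
  - by apply/measurable_EFinP; apply: measurable_funX; exact: measurable_ReM.
have sumE : (\int[P]_o (complex.Re (g * w i o) ^+ 2)%:E +
    \int[P]_o (complex.Im (g * w i o) ^+ 2)%:E = (modulus g ^+ 2 * sigma2)%:E)%E.
  rewrite -ge0_integralD //; first last.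
  - by apply/measurable_EFinP; apply: measurable_funX; exact: noise_ImM_measurable.
  - by move=> o _; rewrite lee_fin sqr_ge0.
  - by apply/measurable_EFinP; apply: measurable_funX; exact: noise_ReM_measurable.
  - by move=> o _; rewrite lee_fin sqr_ge0.
  case: hw => _ _ _ /(_ i)[_ _ _]; rewrite unlock => w2.
  rewrite EFinM -w2 -ge0_integralZl_EFin ?sqr_ge0 //.
  - apply: eq_integral => o _.
    by rewrite -EFinD -modulus_sqr modulusM exprMn EFinM.
  - by move=> o _; rewrite lee_fin sqr_ge0.
  - apply/measurable_EFinP.
    apply: (@eq_measurable_fun _ _ _ _ _
      (fun o => complex.Re (1 * w i o) ^+ 2 + complex.Im (1 * w i o) ^+ 2)).
      by move=> o _; rewrite !mul1r modulus_sqr.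
    by apply: measurable_funD; apply: measurable_funX;
      [exact: noise_ReM_measurable | exact: noise_ImM_measurable].
move: sumE; rewrite ReIm.
have : (0 <= \int[P]_o (complex.Im (g * w i o) ^+ 2)%:E)%E.
  by apply: integral_ge0 => o _; rewrite lee_fin sqr_ge0.
case: (\int[P]_o _)%E => // r _ [] rr.
by congr (_%:E); rewrite -rr; field.
Qed.

Lemma noise_Im_Lfun2 g i : (fun o => complex.Im (g * w i o)) \in Lfun P 2%:E.
Proof.
apply: Lfun2_sqr; first exact: noise_ImM_measurable.
by rewrite noise_Im_sqr ltry.
Qed.

Lemma Lfun12 (X : T -> R) : X \in Lfun P 2%:E -> X \in Lfun P 1.
Proof. exact: (Lfun_subset12 (fin_num_measure P _ measurableT)). Qed.

(** A half turn shows that [w i] and its opposite have the same law. *)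
Lemma noise_Im_mean (g : C) i : ('E_P[fun o => complex.Im (g * w i o)%R] = 0)%E.
Proof.
rewrite unlock; apply: integrable_odd_eq0.
  by apply/Lfun1_integrable; apply: Lfun12; exact: noise_Im_Lfun2.
pose f (x : R * R) := (complex.Im (g * of_pair x))%:E.
transitivity (\int[P]_o f (real_pair (w i o)))%E.
  by apply: eq_integral => o _; rewrite /f of_pairK.
transitivity (\int[P]_o f (real_pair (expi pi * w i o)%R))%E; last first.
  apply: eq_integral => o _.
  by rewrite /f of_pairK expi_pi mulN1r mulrN raddfN.
apply: integral_eq_law.
- exact: noise_measurable.
- exact: noise_rot_measurable.
- by move=> B mB; rewrite noise_rot_law.
- by apply/measurable_EFinP; exact: measurable_ImM.
Qed.

(* (w_i, w_j) and (- w_i, w_j) have the same law. *)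
Lemma noise_Im_cross g g' i j : i != j ->
  (\int[P]_o (complex.Im (g * w i o) * complex.Im (g' * w j o))%:E = 0)%E.
Proof.
move=> ij; apply: integrable_odd_eq0.
  by apply/Lfun1_integrable; apply: Lfun2_mul_Lfun1; exact: noise_Im_Lfun2.
pose f (x : (R * R) * (R * R)) :=
  (complex.Im (g * of_pair x.1) * complex.Im (g' * of_pair x.2))%:E.
transitivity (\int[P]_o f (real_pair (w i o), real_pair (w j o)))%E.
  by apply: eq_integral => o _; rewrite /f !of_pairK.
transitivity
    (\int[P]_o f (real_pair (expi pi * w i o)%R, real_pair (w j o)))%E; last first.
  apply: eq_integral => o _.
  by rewrite /f !of_pairK expi_pi mulN1r mulrN raddfN mulNr.
have pairm theta : measurable_fun [set: T]
    (fun o => (real_pair (expi theta * w i o), real_pair (w j o))).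
  by apply: measurable_fun_pair; [exact: noise_rot_measurable|exact: noise_measurable].
have pairm0 : measurable_fun [set: T]
    (fun o => (real_pair (w i o), real_pair (w j o))).
  by apply: measurable_fun_pair; exact: noise_measurable.
have indep B1 B2 : measurable B1 -> measurable B2 ->
    P ((fun o => (real_pair (w i o), real_pair (w j o))) @^-1` (B1 `*` B2)) =
    (P ((fun o => real_pair (w i o)) @^-1` B1) *
     P ((fun o => real_pair (w j o)) @^-1` B2))%E.
  move=> mB1 mB2.
  have [_ ind _ _] := hw.
  (* Mutual independence is applied to the pair [{i, j}]; the events at other indices do not enter
     the product. *)
  have := ind [set i; j]%SET (fun k => if k == i then B1 else B2).
  rewrite big_setU1 ?inE //= big_set1 eqxx eq_sym (negbTE ij) => <-; last first.
    by move=> k; case: ifP.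
  congr (P _); apply/seteqP; split => o /=.
    move=> [oi oj] k; rewrite /= !inE => /orP[] /eqP -> //.
      by rewrite /complex_event /= eqxx.
    by rewrite /complex_event /= eq_sym (negbTE ij).
  move=> h; split.
    by have := h i; rewrite /complex_event /= !inE eqxx; apply.
  have := h j; rewrite /complex_event /= !inE eqxx orbT eq_sym (negbTE ij).
  exact.
apply: integral_eq_law => //.
- apply: law_prod_rect => // B1 B2 mB1 mB2.
  rewrite indep //.
  (* Moving the sign change from the sample to the set [B1] lets [indep] be used again, in the
     reverse direction. *)
  pose N := (fun x => real_pair (expi pi * of_pair x)) @^-1` B1.
  have mN : measurable N.
    by rewrite -[N]setTI; apply: measurable_expiM.
  rewrite -(noise_rot_law pi) //.
  transitivity (P ((fun o => real_pair (w i o)) @^-1` N) *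
     P ((fun o => real_pair (w j o)) @^-1` B2))%E.
    congr (P _ * _)%E; apply/seteqP.
    by split => o; rewrite /N /= of_pairK.
  rewrite -indep //; congr (P _); apply/seteqP.
  by split => o; rewrite /N /= of_pairK.
- apply/measurable_EFinP; apply: measurable_funM.
    exact: (measurableT_comp (measurable_ImM g) measurable_fst).
  exact: (measurableT_comp (measurable_ImM g') measurable_snd).
Qed.

(** The terms are pairwise uncorrelated, so variances add; the factor 1/2 is the share of the noise
    power in one real direction. *)
Lemma noise_variance (g : I -> C) :
  ('V_P[fun o => (\sum_i complex.Im (g i * w i o))%R] =
   ((\sum_i modulus (g i) ^+ 2) * sigma2 / 2)%R%:E)%E.
Proof.
have -> : (fun o => \sum_i complex.Im (g i * w i o)) =
    \sum_i (fun o => complex.Im (g i * w i o)).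
  by apply/funext => o; rewrite fct_sumE.
rewrite variance_sum_uncorrelated ?index_enum_uniq //.
- rewrite !mulr_suml -sumEFin; apply: eq_bigr => i _.
  rewrite varianceE ?noise_Im_Lfun2 // noise_Im_mean expe2 mule0 sube0.
  by rewrite unlock; exact: noise_Im_sqr.
- by move=> i; exact: noise_Im_Lfun2.
- move=> i j ij; rewrite covarianceE; first last.
  + by apply: Lfun2_mul_Lfun1; exact: noise_Im_Lfun2.
  + by apply: Lfun12; exact: noise_Im_Lfun2.
  + by apply: Lfun12; exact: noise_Im_Lfun2.
  by rewrite !noise_Im_mean mule0 sube0 unlock; exact: noise_Im_cross.
Qed.
End noise.
End second_order.

(** * Telescoping of the Hankel double sum *)

Section telescoping.
Context {R : realType}.
Local Notation C := R[i].
Local Open Scope sesquilinear_scope.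

(** The 0-1 mask rewrites a partial sum as one over all [K] samples, from which the weight of each
    sample can be read. *)
Lemma sum_shift_ord (V : pzRingType) (L N K : nat) (x : nat -> V) :
  (L + N = K)%N ->
  \sum_(k < K) (N <= k)%N%:R * x k = \sum_(p < L) x (p + N)%N.
Proof.
move=> <-; rewrite -(big_mkord xpredT (fun k => (N <= k)%N%:R * x k)).
rewrite (@big_cat_nat _ _ _ N) //= ?leq_addl // big_nat.
rewrite big1 => [|k /andP[_ kN]]; last first.
  by rewrite leqNgt kN mul0r.
rewrite add0r -{1}[N]add0n big_addn addnK big_mkord; apply: eq_bigr => p _.
by rewrite leq_addl mul1r.
Qed.

Lemma sum_widen_ord (V : pzRingType) (L K : nat) (x : nat -> V) : (L <= K)%N ->
  \sum_(k < K) (k < L)%N%:R * x k = \sum_(p < L) x p.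
Proof.
move=> LK; rewrite (big_ord_widen K (fun p => x p) LK) [RHS]big_mkcond /=.
by apply: eq_bigr => k _; case: ltnP => _; rewrite ?mul1r ?mul0r.
Qed.

Lemma telescope_double (V : zmodType) (L N : nat) (x : nat -> V) :
  \sum_(p < L) \sum_(q < N) (x (p + q).+1 - x (p + q)%N) =
  \sum_(p < L) (x (p + N)%N - x p).
Proof.
apply: eq_bigr => p _.
rewrite -(big_mkord xpredT (fun q => x (p + q).+1 - x (p + q)%N)).
have := @telescope_sumr V 0 N (fun q => x (p + q)%N) isT; rewrite addn0 => <-.
by apply: eq_bigr => q _; rewrite addnS.
Qed.

(* The weights left on w_k after telescoping over the longer side. *)
Definition end_weight (M K k : nat) : C :=
  (maxn M (K - M) <= k)%N%:R - (k < minn M (K - M))%N%:R.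

(** The summand depends only on [p + q], so the sums can be exchanged when [M] is the longer side.
    Telescoping the longer index leaves the last samples minus the first ones, [minn M (K - M)] of
    each. *)
Lemma hankel_telescope M K (x : nat -> C) : (M <= K)%N ->
  \sum_(p < M) \sum_(q < K - M) (x (p + q).+1 - x (p + q)%N) =
  \sum_(k < K) end_weight M K k * x k.
Proof.
move=> MK; under [RHS]eq_bigr do rewrite /end_weight mulrBl.
rewrite sumrB (@sum_shift_ord _ (minn M (K - M))) ?sum_widen_ord -?sumrB; try lia.
rewrite -telescope_double; case: (leqP M (K - M)) => // _.
rewrite exchange_big /=; apply: eq_bigr => q _; apply: eq_bigr => p _.
by rewrite addnC.
Qed.

Lemma sum_end_weight_sqr M K : (M <= K)%N ->
  \sum_(k < K) (modulus (end_weight M K k)) ^+ 2 = (minn M (K - M)).*2%:R :> R.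
Proof.
move=> MK.
have wE k : (modulus (end_weight M K k)) ^+ 2 =
    (maxn M (K - M) <= k)%N%:R * 1 + (k < minn M (K - M))%N%:R * 1 :> R.
  rewrite modulus_sqr /end_weight.
  have [h1|h1] := leqP (maxn M (K - M)) k; have [h2|h2] := ltnP k (minn M (K - M)).
  (* The two end blocks are disjoint because the minimum is at most the maximum; hence every weight
     is 0, 1 or -1. *)
  - by exfalso; lia.
  - by rewrite subr0 /= expr1n expr0n /= !mulr1n; ring.
  - by rewrite sub0r /= oppr0 sqrrN expr1n expr0n /=; ring.
  - by rewrite subr0 /= expr0n /=; ring.
under eq_bigr do rewrite wE.
rewrite big_split (@sum_shift_ord _ (minn M (K - M)) _ _ (fun=> 1)); last by lia.
rewrite (@sum_widen_ord _ _ _ (fun=> 1)); last by lia.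
by rewrite !sumr_const !card_ord -addnn natrD.
Qed.

(** The test [M.*2 <= K] decides which of [M] and [K - M] is smaller, so both branches become the
    single expression that the weight count produces. *)
Lemma F_MP_minn M K : (0 < M)%N -> (M < K)%N ->
  F_MP M K = (minn M (K - M))%:R / (M * (K - M))%:R ^+ 2 :> R.
Proof.
move=> M0 MK; rewrite /F_MP natrM.
have Mn0 : (M%:R : R) != 0 by rewrite pnatr_eq0; lia.
have Gn0 : ((K - M)%:R : R) != 0 by rewrite pnatr_eq0; lia.
case: ifP => h.
  rewrite (_ : minn M (K - M) = M); last lia.
  by field; rewrite Mn0 Gn0.
rewrite (_ : minn M (K - M) = K - M)%N; last lia.
by field; rewrite Mn0 Gn0.
Qed.

(** Put [x n = conj(z)^n w n]. Since [conj(z) z = 1], the rotated term of index [(p, q)] is the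
    difference [x (p + q).+1 - x (p + q)], ready for telescoping. *)
Lemma pole_derivative_sum K M (z : C) (w : 'I_K -> C) :
  (M < K)%N -> `|z| = 1 ->
  let Dw := hankel1 M (\row_(k < K) w k) - z *: hankel0 M (\row_(k < K) w k) in
  Num.conj z * ((steering M z)^t* *m Dw *m ((steering (K - M) z)^T)^t*) 0 0 =
  \sum_(k < K) end_weight M K k * (Num.conj z ^+ k * w k).
Proof.
move=> MK z1 Dw.
have zz : Num.conj z * z = 1 by rewrite mulrC -normCK z1 expr1n.
(* The default 0 is never reached: [(p + q).+1 < K] on the whole index range. *)
pose x n : C := if insub n is Some k then Num.conj z ^+ n * w k else 0.
have xE n (nK : (n < K)%N) : x n = Num.conj z ^+ n * w (Ordinal nK).
  by rewrite /x insubT.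
have -> : \sum_(k < K) end_weight M K k * (Num.conj z ^+ k * w k) =
    \sum_(k < K) end_weight M K k * x k.
  by apply: eq_bigr => k _; rewrite /x valK.
rewrite -hankel_telescope ?(ltnW MK) // -mulmxA mxE mulr_sumr.
apply: eq_bigr => p _; rewrite !mxE !mulr_sumr; apply: eq_bigr => q _.
rewrite !mxE (xE _ (hankel0_subproof p q)) (xE _ (hankel1_subproof p q)).
rewrite !rmorphXn /= exprS exprD.
set a := w _; set b := w _.
transitivity (Num.conj z * Num.conj z ^+ p * Num.conj z ^+ q * a -
  (Num.conj z * z) * Num.conj z ^+ p * Num.conj z ^+ q * b); first by ring.
by rewrite zz; ring.
Qed.
End telescoping.

(** * The distance error as a linear functional of the noise, and its variance *)

Theorem theorem1 (R : realType) (K M : nat) (hK : (2 <= K)%N)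
    (hM1 : (1 <= M)%N) (hMK : (M <= K - 1)%N)
    (c Df sigma2 : R) (hc : 0 < c) (hDf : 0 < Df) (hsigma2 : 0 < sigma2)
    (beta z : R[i]) (tau : R) (hbeta : beta != 0)
    (hz : z = expi (- (2 * pi * Df * tau)))
    (d : measure_display) (T : measurableType d) (P : probability T R)
    (w : 'I_K -> T -> R[i]) (hw : iid_cscg P sigma2 w)
    (u : 'rV[R[i]]_K -> 'cV[R[i]]_M) (hu : svd_choice u)
    (arg : R[i] -> R) (harg : arg_branch_near arg z) :
  [/\ forall omega : T,
        derivable (distance_along_noise c Df arg u beta z (w ^~ omega)
                   : R -> R^o) 0 1,
      measurable_fun [set: T]
        (fun omega : T => first_order_error c Df arg u beta z (w ^~ omega)) &
      high_snr_variance P c Df arg u beta z w =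
        ((c / (2 * pi * Df)) ^+ 2 * (sigma2 / modulus beta ^+ 2) *
         F_MP M K)%:E].
Proof.
have MK : (M < K)%N by lia.
have z1 : `|z| = 1 by rewrite hz norm_expi.
pose kc := - (c / (2 * pi * Df)).
(* Coefficient of [w k] under the imaginary part: the factor [kc] from angle to distance, the
   telescoped weight with its rotation, and the normalisation of the pole derivative. *)
pose g (k : 'I_K) : R[i] := kc%:C *
  (end_weight M K k * Num.conj z ^+ k / (beta * (M * (K - M))%:R)).
pose err (omega : T) := \sum_(k < K) complex.Im (g k * w k omega).
have der omega : is_derive (0 : R) (1 : R)
    (distance_along_noise c Df arg u beta z (w ^~ omega) : R -> R^o) (err omega).
  have [y yy0 fE] := mp_pole_expansion (w ^~ omega) hM1 MK hbeta z1 hu.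
  have darg := arg_is_derive z1 harg yy0 fE.
  have -> : (distance_along_noise c Df arg u beta z (w ^~ omega) : R -> R^o) =
      kc \*: (fun t => arg (mp_pole u (observation beta z (w ^~ omega) t)) : R^o).
    apply/funext => t.
    rewrite /distance_along_noise /mp_distance /mp_delay /kc /= /GRing.scale /=; ring.
  apply: is_derive_eq.
  rewrite mulrA pole_derivative_sum // mulr_suml.
  rewrite raddf_sum scaler_sumr; apply: eq_bigr => k _.
  rewrite /g -[kc *: _]/(kc * _) -!mulrA.
  have ReZ (x : R[i]) : kc * complex.Im x = complex.Im (kc%:C * x).
    by case: x => a b /=; rewrite mul0r addr0.
  rewrite ReZ; congr (complex.Im (_ * (_ * _))); rewrite !mulrA; ring.
(* The derivative exists for every outcome, so this identity is pointwise and measurability reduces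
   to that of a finite sum. *)
have errE : (fun omega => first_order_error c Df arg u beta z (w ^~ omega)) = err.
  apply/funext => omega; rewrite /first_order_error derive1E.
  by have := der omega => ?; rewrite derive_val.
split.
- by move=> omega; have [] := der omega.
- rewrite errE; apply: measurable_sum => k.
  exact: (noise_ImM_measurable hw).
rewrite /high_snr_variance errE (noise_variance hw); congr (_%:E).
rewrite F_MP_minn //.
have b0 : modulus beta != 0.
  by apply: contra_neq hbeta => b0; apply/normr0_eq0; rewrite modulusE b0.
have mc (x : R) : modulus (x%:C) ^+ 2 = x ^+ 2.
  by rewrite modulus_sqr /= expr0n addr0.
have MG : ((M * (K - M))%:R : R) != 0.
  by rewrite pnatr_eq0 -lt0n muln_gt0 hM1 subn_gt0.
under eq_bigr => k _.
  have -> : modulus (g k) ^+ 2 = modulus (end_weight M K k) ^+ 2 *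
      (kc ^+ 2 / (modulus beta ^+ 2 * (M * (K - M))%:R ^+ 2)).
    have zk : modulus (Num.conj z ^+ k) = 1.
      by apply: complexI; rewrite -modulusE normrX norm_conjC z1 expr1n.
    have inv : modulus ((beta * (M * (K - M))%:R)^-1) =
        (modulus beta * (M * (K - M))%:R)^-1.
      apply: complexI; rewrite -modulusE normfV normrM normr_nat modulusE.
      rewrite fmorphV; congr (_^-1).
      by rewrite (rmorphM (real_complex R)) /= rmorph_nat.
    rewrite /g !modulusM zk inv !exprMn mc exprVn exprMn expr1n; ring.
  over.
(* The count [2 min(M, K - M)] of surviving samples cancels the 1/2 from [noise_variance], leaving
   the numerator of [F_MP_minn]. *)
rewrite -mulr_suml sum_end_weight_sqr ?(ltnW MK) // -addnn natrD /kc.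
have pi0 : (pi : R) != 0 by rewrite gt_eqF ?pi_gt0.
have Df0 : Df != 0 by rewrite gt_eqF.
move: (pi : R) pi0 (_%:R) MG (modulus beta) b0 => p p0 q q0 b b0.
by field; rewrite p0 q0 b0 Df0.
Qed.
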